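(* Let $r\ge 5$ and let $M$ be a simple ternary matroid (i.e. representable over $GF(3)$) of rank $r$ that contains a loose element and has no coloops. If $r>10$, then $|E(M)|\le \left\lfloor \frac{41r-101}{2}\right\rfloor$. If $r\le 10$, then $|E(M)|\le \left\lfloor \frac{35r-35}{2}\right\rfloor$.
   Context: All matroids are finite. An element $t$ of a matroid $M$ is loose if every circuit of $M$ containing $t$ has size at least the rank $r(M)$. *)

(* Defs.v *)
From mathcomp Require Import all_boot all_algebra.
Set Implicit Arguments. Unset Strict Implicit. Unset Printing Implicit Defensive.
Import GRing.Theory.

Record matroid (T : finType) := Matroid {
  indep : {set T} -> bool;
  indep0 : indep set0;
  indep_sub : forall A B : {set T}, A \subset B -> indep B -> indep A;
  indep_aug : forall A B : {set T}, indep A -> indep B -> #|A| < #|B| ->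
     exists2 x, x \in B :\: A & indep (x |: A)
}.

Section MatroidDefs.
Variables (T : finType) (M : matroid T).

Definition mrank (X : {set T}) : nat :=
  \max_(A : {set T} | (A \subset X) && indep M A) #|A|.

Definition rk : nat := mrank setT.

Definition circuit (C : {set T}) : bool :=
  ~~ indep M C && [forall D : {set T}, (D \proper C) ==> indep M D].

Definition basis (B : {set T}) : bool :=
  indep M B && [forall B' : {set T}, (B \proper B') ==> ~~ indep M B'].

Definition coloop (e : T) : Prop := forall B, basis B -> e \in B.

(* simple: no loops and no parallel pairs, i.e. no circuit of size 1 or 2 *)
Definition simple : Prop := forall C, circuit C -> 2 < #|C|.

Definition loose (t : T) : Prop := forall C, circuit C -> t \in C -> rk <= #|C|.

Definition ternary : Prop :=
  exists (n : nat) (v : T -> 'rV['F_3]_n),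
    forall A : {set T}, indep M A = free [seq v e | e <- enum A].

End MatroidDefs.

(* Main.v *)
Require Import Defs.
From mathcomp Require Import all_boot all_algebra.
From mathcomp Require Import zify.
Set Implicit Arguments. Unset Strict Implicit. Unset Printing Implicit Defensive.
Import GRing.Theory.
Local Open Scope ring_scope.

(** Write the loose element t as a combination of a set D of other elements
    with |D| minimal; then |D| is r or r - 1, and D together with at most one
    further element b0 is a basis.  Scale the coordinates on D so that t becomes
    the all-ones vector.  If k elements of M \ t have a combination with zero
    b0-coordinate, then its D-part has at most k entries equal to 1, since
    otherwise the ones could be exchanged for these k elements, contradicting
    the minimality of |D|.

    Scale the elements so that their b0-coordinate is 0 or 1, and fix one of the
    two values.  The D-parts form a set W of vectors over GF(3) in which x - y
    has at most 2 ones and +-(x + y + z) has at most 3.  Project away one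
    coordinate: the fibres with at least two elements allow that coordinate of
    x - y, or of +-(x + y + z), to be set to 1, so their images satisfy the same
    conditions with bounds 1 and 2, and there are at most 3 of them.  Hence each
    coordinate contributes at most 6 elements to W, so that |W| <= 6 |D| + 1 and
    |E(M)| <= 12 (r - 1) + 3, or |E(M)| <= 6 r + 2 if there is no b0.  Both are
    below the two bounds of the theorem. *)

(** * Arithmetic in GF(3) *)

Lemma F3_cases (a : 'F_3) : [\/ a = 0, a = 1 | a = -1].
Proof.
by case: a => [[|[|[|]]]] // h; [constructor 1|constructor 2|constructor 3];
  apply/val_inj.
Qed.

(** The sumset of two 2-element subsets of Z/3 is all of Z/3, an instance of Cauchy-Davenport. *)
Lemma F3_sum_two (a a' b b' c : 'F_3) : a != a' -> b != b' ->
  [|| a + b == c, a + b' == c, a' + b == c | a' + b' == c].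
Proof.
by case: (F3_cases a) => ->; case: (F3_cases a') => -> // _;
  case: (F3_cases b) => ->; case: (F3_cases b') => -> // _;
  case: (F3_cases c) => ->.
Qed.

Lemma F3_sqr (a : 'F_3) : a != 0 -> a * a = 1.
Proof. by move=> a0; apply/eqP; case: (F3_cases a) a0 => ->. Qed.

Lemma F3_sub_sub (a b c : 'F_3) : a - c + (b - c) = c + a + b.
Proof.
by apply/eqP; case: (F3_cases a) => ->; case: (F3_cases b) => ->;
  case: (F3_cases c) => ->.
Qed.

Lemma card_F3 : #|{: 'F_3}| = 3%N.
Proof. by rewrite card_Fp. Qed.

(** * Thin sets of vectors *)

Definition ones (I : finType) (u : {ffun I -> 'F_3}) : nat :=
  #|[set i | u i == 1]|.
Arguments ones {I} u%_R.

(** Differences need one sign only, because [x] and [y] may be swapped; a sum of three has no such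
    symmetry, so its negative is bounded separately. *)
Definition thin (I : finType) (b : nat) (W : {set {ffun I -> 'F_3}}) : Prop :=
  {in W &, forall x y, x != y -> (ones (x - y) <= b)%N} /\
  {in W & &, forall x y z, x != y -> x != z -> y != z ->
     (ones (x + y + z) <= b.+1)%N /\ (ones (- (x + y + z)) <= b.+1)%N}.

(** * A finite check in GF(3)^3 *)

Definition vec3 := ('F_3 * 'F_3 * 'F_3)%type.

Definition ones3 (u : vec3) : nat := (u.1.1 == 1) + (u.1.2 == 1) + (u.2 == 1).

Definition le_ones3 (b : nat) (u : vec3) : bool :=
  (ones3 u <= b)%N && (ones3 (- u)%R <= b)%N.

Definition enum_vec3 : seq vec3 :=
  let F := [:: 0; 1; -1] in
  [seq (p, c) | p <- [seq (a, b) | a <- F, b <- F], c <- F].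

Lemma mem_enum_vec3 (u : vec3) : u \in enum_vec3.
Proof.
by case: u => [[a b] c]; case: (F3_cases a) => ->; case: (F3_cases b) => ->;
  case: (F3_cases c) => ->.
Qed.

Definition thin_pair3 (u w : vec3) : bool :=
  [&& u != w, le_ones3 1 (u - w) & le_ones3 2 (u + w)].

(** The three vectors play the role of differences of members of a thin set from a fourth member
    [p]. In characteristic 3 the sum of two of them is a triple sum containing [p], and the sum of
    all three is the triple sum omitting [p]. *)
Lemma no_thin_triple3 (u w y : vec3) :
  u != 0 -> w != 0 -> y != 0 ->
  le_ones3 1 u -> le_ones3 1 w -> le_ones3 1 y ->
  thin_pair3 u w -> thin_pair3 u y -> thin_pair3 w y ->
  ~~ le_ones3 2 (u + w + y).
Proof.
pose L := [seq x <- enum_vec3 | (x != 0) && le_ones3 1 x].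
have inL x : x != 0 -> le_ones3 1 x -> x \in L.
  by move=> x0 x1; rewrite mem_filter x0 x1 mem_enum_vec3.
have check : all (fun x => all (fun z => thin_pair3 x z ==>
    all (fun t => thin_pair3 x t && thin_pair3 z t ==>
      ~~ le_ones3 2 (x + z + t)) L) L) L by vm_compute.
move=> u0 w0 y0 u1 w1 y1 uw uy wy.
move/allP/(_ u (inL _ u0 u1))/allP/(_ w (inL _ w0 w1)): check.
rewrite uw => /allP/(_ y (inL _ y0 y1)).
by rewrite uy wy.
Qed.

(** * Cardinality of thin sets *)

Section Thin.
Variable I : finType.
Implicit Types (u p q x y z : {ffun I -> 'F_3}) (Q : seq {ffun I -> 'F_3}).

(** As [h] is injective on [Q], at most one [q] in [Q] collides with [p]; any coordinate where [p]
    and [q] differ repairs this collision. *)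
Lemma separating_coordinate (A : eqType) (h : {ffun I -> 'F_3} -> A) Q p :
  Q != [::] -> {in Q &, injective h} -> p \notin Q ->
  exists k, {in p :: Q &, injective (fun q => (h q, q k))}.
Proof.
move=> Q0 injh pQ.
have [q qQ hq] : exists2 q, q \in Q & forall q', q' \in Q -> h q' = h p -> q' = q.
  have [/hasP[q qQ /eqP hqp]|/hasPn noh] := boolP (has (fun q => h q == h p) Q).
    by exists q => // q' q'Q hq'; apply: injh; rewrite ?hq'.
  (* Nothing collides with [p], and any [q] will do: it only serves to produce some coordinate. *)
  case: Q Q0 {injh pQ} noh => // q Q _ noh; exists q; rewrite ?mem_head //.
  by move=> q' /noh /eqP.
have /existsP[k kP] : [exists k, p k != q k].
  apply: contraR pQ; rewrite negb_exists => /forallP e.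
  by rewrite (_ : p = q) //; apply/ffunP => k; apply/eqP; move: (e k); case: eqP.
exists k => a b; rewrite !inE => /predU1P[->|aQ] /predU1P[->|bQ] // [ab abk].
- by move: kP; rewrite abk (hq b) ?eqxx.
- by move: kP; rewrite -abk (hq a) ?eqxx.
- exact: injh.
Qed.

(* Repeated coordinates are masked by 0 so that no 1 is counted twice. *)
Definition restrict3 (i j k : I) u : vec3 :=
  (u i, (j != i)%:R * u j, (k \notin [:: i; j])%:R * u k).

Lemma restrict3D i j k : {morph restrict3 i j k : x y / x + y}.
Proof. by move=> x y; rewrite /restrict3 !ffunE !mulrDr. Qed.

Lemma restrict3N i j k : {morph restrict3 i j k : x / - x}.
Proof. by move=> x; rewrite /restrict3 !ffunE !mulrN. Qed.

Lemma ones_restrict3 i j k u : (ones3 (restrict3 i j k u) <= ones u)%N.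
Proof.
rewrite /ones3 /restrict3 /=.
have le1 (b : bool) l : (b%:R * u l == 1) = b && (u l == 1).
  by case: b; rewrite ?mul1r ?mul0r.
rewrite !le1.
have sub (s : seq I) : uniq s -> (count (fun l => u l == 1%R) s <= ones u)%N.
  move=> us; rewrite -size_filter /ones cardE uniq_leq_size ?filter_uniq // => l.
  by rewrite mem_filter mem_enum inE => /andP[].
rewrite !inE !negb_or; have [->|ji] := eqVneq j i => /=; have [->|ki] := eqVneq k i => /=.
- by apply: leq_trans (sub [:: i] isT); rewrite /= !addn0.
- by apply: leq_trans (sub [:: i; k] _); rewrite /= ?inE 1?eq_sym ?ki //; lia.
- by apply: leq_trans (sub [:: i; j] _); rewrite /= ?inE 1?eq_sym ?ji //; lia.
- have [->|kj] := eqVneq k j => /=.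
    by apply: leq_trans (sub [:: i; j] _); rewrite /= ?inE 1?eq_sym ?ji //; lia.
  by apply: leq_trans (sub [:: k; i; j] _); rewrite /= ?inE ?negb_or ?ki ?kj 1?eq_sym ?ji //; lia.
Qed.

(* Four distinct vectors are already separated by at most three coordinates, so
   it suffices to exclude a thin quadruple in GF(3)^3, which is a finite check. *)
Lemma thin1_card (R : {set {ffun I -> 'F_3}}) : thin 1 R -> (#|R| <= 3)%N.
Proof.
case=> R2 R3; rewrite leqNgt; apply/negP; rewrite cardE.
case e: (enum R) (enum_uniq R) => [|p [|x [|y [|z s]]]] //.
rewrite /= !inE !negb_or -!andbA.
case/and5P=> px py pz _ /and4P[xy xz _ /andP[yz _]] _.
have memR q : q \in [:: p; x; y; z] -> q \in R.
  by rewrite -(mem_enum R) e !inE => /or4P[] ->; rewrite ?orbT.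
have [pR xR yR zR] : [/\ p \in R, x \in R, y \in R & z \in R].
  by split; apply: memR; rewrite !inE eqxx ?orbT.
have [i i_inj] : exists i, {in [:: x; p] &, injective (fun q => (tt, q i))}.
  apply: separating_coordinate => //; last by rewrite inE eq_sym.
  by move=> ? ?; rewrite !inE => /eqP-> /eqP->.
have [j j_inj] : exists j, {in [:: y; x; p] &, injective (fun q => (tt, q i, q j))}.
  by apply: separating_coordinate => //; rewrite !inE negb_or !(eq_sym y) xy.
have [k k_inj] : exists k,
    {in [:: z; y; x; p] &, injective (fun q => (tt, q i, q j, q k))}.
  by apply: separating_coordinate => //; rewrite !inE !negb_or !(eq_sym z) yz xz.
pose g := restrict3 i j k.
have gB u w : g (u - w) = g u - g w by rewrite /g restrict3D restrict3N.
have g_neq u w : u \in [:: z; y; x; p] -> w \in [:: z; y; x; p] -> u != w -> g u != g w.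
  move=> us ws; apply: contraNneq => /eqP.
  rewrite !xpair_eqE => /andP[/andP[/eqP ei /eqP ej] /eqP ek]; apply/eqP; apply: k_inj => //.
  have ej' : u j = w j.
    by move: ej; have [->|_] := eqVneq j i => //=; rewrite !mul1r.
  have ek' : u k = w k.
    move: ek; rewrite !inE negb_or; have [->|_] := eqVneq k i => //.
    by have [->|_] := eqVneq k j => //=; rewrite !mul1r.
  by rewrite ei ej' ek'.
have gle b u : (ones u <= b)%N -> (ones (- u) <= b)%N -> le_ones3 b (g u).
  move=> u1 u2; rewrite /le_ones3 -restrict3N.
  by rewrite (leq_trans (ones_restrict3 i j k u)) ?(leq_trans (ones_restrict3 i j k _)).
have g2 u w : u \in R -> w \in R -> u != w -> le_ones3 1 (g u - g w).
  by move=> uR wR uw; rewrite -gB; apply: gle; rewrite ?opprB R2 // eq_sym.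
have shift u w : u - p + (w - p) = p + u + w.
  by apply/ffunP => l; rewrite !ffunE F3_sub_sub.
have g3 u w t : u \in R -> w \in R -> t \in R -> u != w -> u != t -> w != t ->
    le_ones3 2 (g (u + w + t)).
  by move=> uR wR tR uw ut wt; case: (R3 u w t) => // *; apply: gle.
have pair u w : u \in R -> w \in R -> g u != g w -> p != u -> p != w -> u != w ->
    thin_pair3 (g (u - p)) (g (w - p)).
  move=> uR wR guw pu pw uw; rewrite /thin_pair3 -restrict3D shift g3 //.
  rewrite !gB (inj_eq (addIr _)) guw /=.
  by rewrite opprB addrA subrK g2.
have : ~~ le_ones3 2 (g (x - p) + g (y - p) + g (z - p)).
  have mem q : (q \in [:: z; y; x; p]) = [|| q == z, q == y, q == x | q == p].
    by rewrite !inE.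
  by apply: no_thin_triple3; rewrite ?pair ?gB ?subr_eq0 ?g2 ?g_neq // ?mem ?eqxx ?orbT // eq_sym.
rewrite -!restrict3D shift.
have -> : p + x + y + (z - p) = x + y + z.
  by rewrite -!addrA [p + _]addrC !addrA subrK.
by rewrite g3.
Qed.

(** Zeroing the coordinate, rather than shrinking the index type, keeps the image in the same space,
    so the projection can be iterated. *)
Definition drop_coord (i : I) u : {ffun I -> 'F_3} :=
  [ffun j => if j == i then 0 else u j].

Lemma drop_coordD i : {morph drop_coord i : x y / x + y}.
Proof. by move=> x y; apply/ffunP => j; rewrite !ffunE; case: eqP; rewrite ?addr0. Qed.

Lemma drop_coordN i : {morph drop_coord i : x / - x}.
Proof. by move=> x; apply/ffunP => j; rewrite !ffunE; case: eqP; rewrite ?oppr0. Qed.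

Lemma ones_drop_coord i u : ones u = (ones (drop_coord i u) + (u i == 1%R))%N.
Proof.
rewrite /ones (cardsD1 i) inE addnC; congr (_ + _)%N; apply: eq_card => j.
by rewrite !inE !ffunE; case: eqP.
Qed.

(** * Projection along one coordinate *)

Section ThinProjection.
Variables (i : I) (W : {set {ffun I -> 'F_3}}).
Hypothesis W_thin : thin 2 W.

Let W' := drop_coord i @: W.
Let fiber x := [set w in W | drop_coord i w == x].
Let rich := [set x in W' | (1 < #|fiber x|)%N].

Lemma thin2_drop_coord : thin 2 W'.
Proof.
have le_drop b u : (ones u <= b)%N -> (ones (drop_coord i u) <= b)%N.
  by rewrite (ones_drop_coord i u) => /(leq_trans (leq_addr _ _)).
case: W_thin => W2 W3; split.
  move=> _ _ /imsetP[x xW ->] /imsetP[y yW ->] xy.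
  rewrite -drop_coordN -drop_coordD; apply/le_drop/W2 => //.
  by apply: contraNneq xy => ->.
move=> _ _ _ /imsetP[x xW ->] /imsetP[y yW ->] /imsetP[z zW ->] xy xz yz.
rewrite -!drop_coordD -drop_coordN.
have [|||le1 le2] := W3 x y z xW yW zW; last by split; apply: le_drop.
- by apply: contraNneq xy => ->.
- by apply: contraNneq xz => ->.
- by apply: contraNneq yz => ->.
Qed.

Lemma rich_fiber x : x \in rich -> exists w w', [/\ w \in W, w' \in W,
  drop_coord i w = x, drop_coord i w' = x & w i != w' i].
Proof.
rewrite /rich inE => /andP[_ /card_gt1P[w [w' []]]].
rewrite /fiber !inE => /andP[wW /eqP wx] /andP[w'W /eqP w'x] ww'.
exists w, w'; split=> //; apply: contraNneq ww' => e; apply/eqP/ffunP => j.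
have [->//|ji] := eqVneq j i.
by move/ffunP/(_ j): (etrans wx (esym w'x)); rewrite !ffunE (negPf ji).
Qed.

(* Two rich fibres can be lifted so that the i-th coordinates add up to any
   prescribed value, which yields one extra entry equal to 1. *)
Lemma rich_lift2 x y (c : 'F_3) : x \in rich -> y \in rich ->
  exists w w', [/\ w \in W, w' \in W, drop_coord i w = x, drop_coord i w' = y
    & w i + w' i = c].
Proof.
move=> /rich_fiber[w1 [w2 [w1W w2W w1x w2x w12]]].
move=> /rich_fiber[u1 [u2 [u1W u2W u1y u2y u12]]].
by case/or4P: (F3_sum_two c w12 u12) => /eqP e;
  [exists w1, u1 | exists w1, u2 | exists w2, u1 | exists w2, u2].
Qed.

(** Lifts are chosen so that coordinate [i] of the difference, or of the signed triple sum, equals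
    1. This uses up one of the ones allowed in [W], and the projection keeps one fewer. In a triple,
    two lifts are adjusted and the third is arbitrary. *)
Lemma thin1_rich : thin 1 rich.
Proof.
case: W_thin => W2 W3; split.
  move=> x y xR yR xy.
  have [w1 [w2 [w1W w2W w1x w2x w12]]] := rich_fiber xR.
  have [u1 [u2 [u1W u2W u1y u2y u12]]] := rich_fiber yR.
  have u12' : - u1 i != - u2 i by rewrite (inj_eq oppr_inj).
  have [w [u [wW uW wx uy e]]] : exists w u, [/\ w \in W, u \in W,
      drop_coord i w = x, drop_coord i u = y & w i - u i = 1].
    by case/or4P: (F3_sum_two 1 w12 u12') => /eqP e;
      [exists w1, u1 | exists w1, u2 | exists w2, u1 | exists w2, u2].
  have := W2 w u wW uW; rewrite (ones_drop_coord i) !ffunE e eqxx addn1 ltnS.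
  rewrite drop_coordD drop_coordN wx uy; apply.
  by apply: contraNneq xy => wu; rewrite -wx -uy wu.
move=> x y z xR yR zR xy xz yz.
have [v [_ [vW _ vz _ _]]] := rich_fiber zR.
have lift (c : 'F_3) : exists w, [/\ drop_coord i w = x + y + z, w i = c,
    (ones w <= 3)%N & (ones (- w) <= 3)%N].
  have [w [u [wW uW wx uy e]]] := rich_lift2 (c - v i) xR yR.
  have [|||le1 le2] := W3 w u v wW uW vW.
  - by apply: contraNneq xy => wu; rewrite -wx -uy wu.
  - by apply: contraNneq xz => wu; rewrite -wx -vz wu.
  - by apply: contraNneq yz => wu; rewrite -uy -vz wu.
  exists (w + u + v); split=> //; first by rewrite !drop_coordD wx uy vz.
  by rewrite !ffunE e subrK.
split.
  have [w [<- wi le1 _]] := lift 1.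
  by move: le1; rewrite (ones_drop_coord i) wi eqxx addn1.
have [w [<- wi _ le1]] := lift (-1).
by move: le1; rewrite (ones_drop_coord i) ffunE wi opprK eqxx addn1 drop_coordN.
Qed.

(** A fibre is determined by its values at [i], so it has at most 3 members: at most 2 extra ones
    over each of the at most 3 points of [rich]. *)
Lemma thin2_card_drop_coord : (#|W| <= #|W'| + 6)%N.
Proof.
have fiber_le3 x : (#|fiber x| <= 3)%N.
  pose ev (w : {ffun I -> 'F_3}) := w i.
  suff ev_inj : {in fiber x &, injective ev}.
    by rewrite -(card_in_imset ev_inj) (leq_trans (max_card _)) ?card_F3.
  move=> w w'; rewrite /= /fiber !inE => /andP[_ /eqP wx] /andP[_ /eqP w'x] e; apply/ffunP => j.
  have [->//|ji] := eqVneq j i.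
  by move/ffunP/(_ j): (etrans wx (esym w'x)); rewrite !ffunE (negPf ji).
rewrite -sum1_card (partition_big_imset (drop_coord i)) /=.
have /leq_trans-> // : (\sum_(x in W') \sum_(w in W | drop_coord i w == x) 1 <=
    \sum_(x in W') (1 + 2 * (x \in rich)))%N.
  apply: leq_sum => x xW'.
  have -> : (\sum_(w in W | drop_coord i w == x) 1 = #|fiber x|)%N.
    by rewrite -sum1_card; apply: eq_bigl => w; rewrite /fiber inE.
  have le3 := fiber_le3 x; rewrite /rich inE xW' /=.
  by have [//|le1] := ltnP 1 #|fiber x|; rewrite muln0 addn0.
rewrite big_split /= sum1_card leq_add2l -big_distrr /=.
suff -> : (\sum_(x in W') (x \in rich) = #|rich|)%N.
  by rewrite (leq_mul2l 2 _ 3) thin1_card //; apply: thin1_rich.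
rewrite -sum1_card [RHS]big_mkcond [LHS]big_mkcond; apply: eq_bigr => x _.
by rewrite /rich inE; case: (x \in W'); case: ltnP.
Qed.
End ThinProjection.

(** Induction on [#|D|], zeroing one coordinate at a time; the final 1 counts the zero vector, all
    that remains for empty [D]. *)
Lemma thin2_card (D : {set I}) (W : {set {ffun I -> 'F_3}}) :
  thin 2 W -> {in W, forall (w : {ffun I -> 'F_3}) i, i \notin D -> w i = 0} -> (#|W| <= 6 * #|D| + 1)%N.
Proof.
have [n] := ubnP #|D|; elim: n => // n IHn in D W *; rewrite ltnS => Dn Wt Wsupp.
have [D0|[i iD]] := set_0Vmem D.
  rewrite D0 cards0 muln0 add0n.
  apply: (@leq_trans #|[set (0 : {ffun I -> 'F_3})]|); last by rewrite cards1.
  apply/subset_leq_card/subsetP => w wW; rewrite inE; apply/eqP/ffunP => i.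
  by rewrite ffunE Wsupp // D0 inE.
have cD : #|D| = #|D :\ i|.+1 by rewrite (cardsD1 i) iD.
have : (#|drop_coord i @: W| <= 6 * #|D :\ i| + 1)%N.
  apply: IHn; [by rewrite -ltnS -cD | exact: thin2_drop_coord |].
  move=> _ /imsetP[w wW ->] j; rewrite !inE ffunE negb_and negbK.
  by case: eqP => //= _ jD; apply: Wsupp.
by have := thin2_card_drop_coord i Wt; rewrite cD; lia.
Qed.
End Thin.

(** * Independence, circuits and rank *)

Section Matroid.
Variables (T : finType) (M : matroid T).

Lemma indep_leq_rk (A : {set T}) : indep M A -> (#|A| <= rk M)%N.
Proof.
move=> iA; apply: (@leq_bigmax_cond _ _ (fun A : {set T} => #|A|) A).
by rewrite subsetT.
Qed.

Lemma dependent_circuit (A : {set T}) :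
  ~~ indep M A -> exists2 C, circuit M C & C \subset A.
Proof.
move=> /(minset_exists (P := fun B : {set T} => ~~ indep M B))[C /minsetP[dC minC] CA].
exists C => //; rewrite /circuit dC; apply/forallP => D; apply/implyP => DC.
have := DC; apply: contraTT => dD; rewrite (minC D dD (proper_sub DC)).
by rewrite properxx.
Qed.

(** * Linear relations among the represented elements *)

Section Relations.
Variables (n : nat) (v : T -> 'rV['F_3]_n).
Hypothesis vP : forall A : {set T}, indep M A = free [seq v e | e <- enum A].
Implicit Types c d : {ffun T -> 'F_3}.

Definition supp c : {set T} := [set e | c e != 0].
(** Coefficients live on all of [T], with [supp] recording where they matter, so relations on
    different sets can be added directly. *)
Definition comb c := \sum_e c e *: v e.

Lemma suppN c e : e \notin supp c -> c e = 0.
Proof. by rewrite inE negbK => /eqP. Qed.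

Lemma comb_supp c (A : {set T}) : supp c \subset A ->
  comb c = \sum_(e in A) c e *: v e.
Proof.
move=> sA; rewrite /comb [RHS]big_mkcond; apply: eq_bigr => e _.
case: ifP => // /negbT eA; rewrite suppN ?scale0r //.
by apply: contra eA; apply: (subsetP sA).
Qed.

Lemma indep_comb (A : {set T}) c :
  indep M A -> supp c \subset A -> comb c = 0 -> c = 0.
Proof.
rewrite vP => /(@freeP _ _ _ [tuple of [seq v e | e <- enum_tuple A]]) fr sA.
rewrite (comb_supp sA) big_enum_val /= => c0.
have cA := fr (fun i => c (enum_val i)).
apply/ffunP => e; rewrite ffunE; have [eA|eA] := boolP (e \in A); last first.
  by apply: suppN; apply: contra eA; apply: (subsetP sA).
rewrite -(enum_rankK_in eA eA); apply: cA; rewrite -[RHS]c0; apply: eq_bigr => i _.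
congr (_ *: _); rewrite (nth_map e) -?cardE //.
by rewrite (enum_val_nth e).
Qed.

Lemma dependent_comb (A : {set T}) : ~~ indep M A ->
  exists c, [/\ c != 0, supp c \subset A & comb c = 0].
Proof.
move=> dA; have /existsP[c /and3P[c0 sA /eqP cc]] :
    [exists c : {ffun T -> 'F_3}, [&& c != 0, supp c \subset A & comb c == 0]]; last by exists c.
apply: contraR dA; rewrite negb_exists => /forallP noc; rewrite vP.
apply/(@freeP _ _ _ [tuple of [seq v e | e <- enum_tuple A]]) => k k0 i.
pose c := [ffun e => if [pick j | enum_val j == e :> T] is Some j then k j else 0].
have cE (j : 'I_#|A|) : c (enum_val j) = k j.
  rewrite ffunE; case: pickP => [j' /eqP/enum_val_inj-> //|/(_ j)].
  by rewrite eqxx.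
have sA : supp c \subset A.
  apply/subsetP => e; rewrite inE ffunE; case: pickP => [j /eqP<- _|]; last by rewrite eqxx.
  exact: enum_valP.
have := noc c; rewrite sA /= negb_and negbK.
have -> : comb c = 0.
  rewrite (comb_supp sA) big_enum_val -[RHS]k0; apply: eq_bigr => j _.
  (* The element [e] is only a default value for [nth]. *)
  rewrite cE; congr (_ *: _); have [e _] : exists e : T, True by exists (enum_val j).
  by rewrite (nth_map e) -?cardE // (enum_val_nth e).
by rewrite eqxx orbF => /eqP cz; rewrite -cE cz ffunE.
Qed.

Lemma combD c d : comb (c + d) = comb c + comb d.
Proof. by rewrite /comb -big_split; apply: eq_bigr => e _; rewrite ffunE scalerDl. Qed.

Definition scl (a : 'F_3) c : {ffun T -> 'F_3} := [ffun e => a * c e].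

Lemma comb_scl (a : 'F_3) c : comb (scl a c) = a *: comb c.
Proof. by rewrite /comb scaler_sumr; apply: eq_bigr => e _; rewrite ffunE scalerA. Qed.

Lemma combN c : comb (- c) = - comb c.
Proof. by rewrite /comb -sumrN; apply: eq_bigr => e _; rewrite ffunE scaleNr. Qed.

Lemma comb0 : comb 0 = 0.
Proof. by rewrite /comb big1 // => e _; rewrite ffunE scale0r. Qed.

Definition delta (e : T) : {ffun T -> 'F_3} := [ffun x => (x == e)%:R].

Lemma comb_delta e : comb (delta e) = v e.
Proof.
rewrite /comb (bigD1 e) //= big1 ?addr0 ?ffunE ?eqxx ?scale1r // => x xe.
by rewrite ffunE (negPf xe) scale0r.
Qed.

(** The list [s] of weighted elements is a formal combination; applied to [delta], to [y] or to [x],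
    it gives the same combination in three coordinate systems. *)
Definition scl_sum (s : seq (T * 'F_3)) (f : T -> {ffun T -> 'F_3}) :=
  \sum_(p <- s) scl p.2 (f p.1).

Lemma scl_sumE s f e : scl_sum s f e = \sum_(p <- s) p.2 * f p.1 e.
Proof.
by rewrite /scl_sum sum_ffunE; apply: eq_bigr => p _; rewrite ffunE.
Qed.

Lemma comb_scl_sum s f : comb (scl_sum s f) = \sum_(p <- s) p.2 *: comb (f p.1).
Proof.
rewrite /scl_sum (big_morph comb combD comb0).
by apply: eq_bigr => p _; rewrite comb_scl.
Qed.

Lemma simple_supp c : simple M -> c != 0 -> comb c = 0 -> (2 < #|supp c|)%N.
Proof.
move=> sM c0 cc; have [C cC Cs] : exists2 C, circuit M C & C \subset supp c.
  apply: dependent_circuit; apply: contraNN c0 => ic; apply/eqP.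
  exact: indep_comb ic _ cc.
exact: leq_trans (sM _ cC) (subset_leq_card Cs).
Qed.

(** * Relations of minimal support through a fixed element *)

Section Loose.
Variables (t : T) (c : {ffun T -> 'F_3}).
Hypotheses (ct : c t != 0) (cc : comb c = 0).
Hypothesis c_min : forall d : {ffun T -> 'F_3}, d t != 0 -> comb d = 0 -> (#|supp c| <= #|supp d|)%N.

(** Otherwise subtracting a multiple of [d] cancels an entry of [c] without changing its entry at
    [t], contradicting minimality. *)
Lemma min_comb_supp d : supp d \subset supp c -> d t = 0 -> comb d = 0 -> d = 0.
Proof.
move=> dc dt cd; apply/ffunP => e; rewrite ffunE; apply/eqP/negPn/negP => de.
pose c' := c + scl (- (c e / d e)) d.
have c't : c' t = c t by rewrite !ffunE dt mulr0 addr0.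
have := c_min (d := c'); rewrite c't combD comb_scl cc cd scaler0 addr0.
move=> /(_ ct erefl); apply/negP; rewrite -ltnNge; apply: proper_card.
apply/properP; split.
  apply/subsetP => x; apply: contraTT => xc; rewrite inE negbK !ffunE (suppN xc).
  by rewrite (@suppN d x) ?mulr0 ?addr0 //; apply: contra xc; apply: (subsetP dc).
exists e; first by apply: (subsetP dc); rewrite inE.
by rewrite inE negbK !ffunE mulNr divfK // subrr.
Qed.

(** The support contains a circuit. This circuit passes through [t], since a relation inside it
    avoiding [t] would vanish by [min_comb_supp]. *)
Lemma loose_min_comb : loose M t -> (rk M <= #|supp c|)%N.
Proof.
move=> lt; have [C cC Cs] : exists2 C, circuit M C & C \subset supp c.
  apply: dependent_circuit; apply: contraNN ct => ic.
  by rewrite (indep_comb ic (subxx _) cc) ffunE.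
apply: leq_trans (lt C cC _) (subset_leq_card Cs).
apply/negPn/negP => tC; have /andP[dC _] := cC.
have [d [d0 dC' cd]] := dependent_comb dC.
case/eqP: d0; apply: min_comb_supp (subset_trans dC' Cs) _ cd.
by apply: suppN; apply: contra tC; apply: (subsetP dC').
Qed.

End Loose.

(** * Coordinates adapted to a loose element *)

Lemma noncoloop_comb t : ~ coloop M t -> exists2 c : {ffun T -> 'F_3}, c t != 0 & comb c = 0.
Proof.
move=> nt; have /existsP[B /andP[/andP[iB /forallP maxB] tB]] :
    [exists B : {set T}, basis M B && (t \notin B)].
  apply: contra_notT nt => /existsPn h B bB.
  by have := h B; rewrite bB negbK.
have : ~~ indep M (t |: B).
  by apply: (implyP (maxB _)); rewrite properE subsetUr subUset sub1set (negPf tB).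
case/dependent_comb => c [c0 cs cc]; exists c => //.
apply: contraNneq c0 => ct; apply/eqP/(indep_comb iB) => //.
apply/subsetP => e ec; have := subsetP cs e ec; rewrite !inE => /orP[/eqP et|//].
by move: ec; rewrite inE et ct eqxx.
Qed.

(** For [e] outside [B], a relation on [e |: B] must involve [e], and is solved for [v e]. *)
Lemma maximal_indep_span (B : {set T}) e : indep M B ->
  (forall A : {set T}, indep M A -> B \subset A -> A = B) ->
  exists2 y, supp y \subset B & comb y = v e.
Proof.
move=> iB maxB; have [eB|eB] := boolP (e \in B).
  exists (delta e); last exact: comb_delta.
  by apply/subsetP => x; rewrite inE ffunE; have [->|] := eqVneq x e; rewrite ?eqxx.
have : ~~ indep M (e |: B).
  apply: contra eB => /maxB/(_ (subsetUr _ _)) <-; exact: setU11.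
case/dependent_comb => d [d0 ds cd].
have inB x : x != e -> x \notin B -> d x = 0.
  move=> xe xB; apply: suppN; apply: contra xB => /(subsetP ds).
  by rewrite !inE (negPf xe).
have de : d e != 0.
  apply: contraNneq d0 => de; apply/eqP/(indep_comb iB) => //.
  apply/subsetP => x; apply: contraTT => xB; rewrite inE negbK.
  by have [->|/inB->] := eqVneq x e; rewrite ?de.
exists (delta e + scl (- (d e)^-1) d); last first.
  by rewrite combD comb_scl cd scaler0 addr0 comb_delta.
apply/subsetP => x; apply: contraTT => xB; rewrite inE negbK !ffunE.
have [->|xe] := eqVneq x e; first by rewrite mulNr mulVf // subrr.
by rewrite (inB x) // mulr0 addr0.
Qed.

(** Here [x e] holds the rescaled coordinates of [e] on [D], and [l e] its coordinate on the at most
    one further basis element. The last clause says that these coordinates determine the vector. *)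
Lemma loose_coordinates t : loose M t -> ~ coloop M t ->
  exists (D : {set T}) (x : T -> {ffun T -> 'F_3}) (l : T -> 'F_3),
  [/\ (#|D| <= rk M)%N /\ (forall e, l e != 0 -> (#|D| < rk M)%N),
      forall e b, b \notin D -> x e b = 0,
      forall s : seq (T * 'F_3), t \notin [seq p.1 | p <- s] ->
        \sum_(p <- s) p.2 * l p.1 = 0 -> (ones (scl_sum s x) <= size s)%N
    & forall e f a a', scl a (x e) = scl a' (x f) -> a * l e = a' * l f ->
        a *: v e = a' *: v f].
Proof.
move=> lt nt; have [c1 c1t cc1] := noncoloop_comb nt.
have [c /andP[ct /eqP cc] c_min'] :
    {c : {ffun T -> 'F_3} | (c t != 0) && (comb c == 0) &
      forall d : {ffun T -> 'F_3}, (d t != 0) && (comb d == 0) -> (#|supp c| <= #|supp d|)%N}.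
  pose P (d : {ffun T -> 'F_3}) := (d t != 0) && (comb d == 0).
  have Pc1 : P c1 by rewrite /P c1t cc1 eqxx.
  by case: (arg_minnP (fun d => #|supp d|) Pc1) => c Pc minc; exists c.
have c_min (d : {ffun T -> 'F_3}) : d t != 0 -> comb d = 0 -> (#|supp c| <= #|supp d|)%N.
  by move=> dt cd; apply: c_min'; rewrite dt cd eqxx.
pose D := supp c :\ t.
have cD : #|supp c| = #|D|.+1 by rewrite (cardsD1 t) inE ct.
have iD : indep M D.
  apply/negPn/negP => /dependent_comb[d [d0 ds cd]]; case/eqP: d0.
  apply: (min_comb_supp ct cc c_min) cd; first exact: subset_trans ds (subsetDl _ _).
  by apply: suppN; apply: (contra (subsetP ds t)); rewrite !inE eqxx.
have [B /maxsetP[iB maxB] DB] := maxset_exists (P := indep M) iD.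
have tB : t \notin B.
  apply: contra ct => tB; rewrite (indep_comb iB _ cc) ?ffunE //.
  apply/subsetP => e ec; have [->//|et] := eqVneq e t.
  by apply: (subsetP DB); rewrite /D in_setD1 et.
have [y /all_and2[ys cy]] : exists y : T -> {ffun T -> 'F_3},
    forall e, supp (y e) \subset B /\ comb (y e) = v e.
  apply: (@fin_all_exists T (fun=> {ffun T -> 'F_3})
    (fun e ye => supp ye \subset B /\ comb ye = v e)) => e.
  by have [ye] := maximal_indep_span e iB maxB; exists ye.
have yB e b : b \notin B -> y e b = 0.
  by move=> bB; apply: suppN; apply: contra bB; apply: (subsetP (ys e)).
have cBD : (#|B :\: D| <= 1)%N.
  rewrite cardsD (setIidPr DB) leq_subLR addn1 -cD.
  exact: leq_trans (indep_leq_rk iB) (loose_min_comb ct cc c_min lt).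
(* If [B] equals [D], the default [t] lies outside [B], so every coordinate at [b0] is zero. *)
pose b0 := odflt t [pick b in B :\: D].
have b0P b : b \in B -> b \notin D -> b = b0.
  move=> bB bD; have bBD : b \in B :\: D by rewrite inE bD.
  rewrite /b0; case: pickP => [b' b'BD|/(_ b)]; last by rewrite bBD.
  exact: (card_le1_eqP cBD).
have b0D : b0 \notin D.
  rewrite /b0; case: pickP => [b /[!inE]/andP[]//|_ /=].
  by rewrite !inE eqxx.
(* Solving [c] for [t] gives its coordinates on [B], by uniqueness; hence they are nonzero exactly
   on [D]. *)
have yt b : b != t -> c b + c t * y t b = 0.
  move=> bt; pose d := c - scl (c t) (delta t - y t).
  have /ffunP/(_ b) : d = 0.
    apply: (indep_comb iB); last first.
      by rewrite combD combN comb_scl combD combN comb_delta cy subrr scaler0 oppr0 addr0.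
    apply/subsetP => e; apply: contraTT => eB; rewrite inE negbK !ffunE yB //.
    have [->|et] := eqVneq e t; first by rewrite subr0 mulr1 subrr.
    rewrite subrr mulr0 subr0 (suppN (c := c)) //.
    by apply: contra eB => ec; apply: (subsetP DB); rewrite /D in_setD1 et.
  by rewrite !ffunE (negPf bt) sub0r mulrN opprK.
have ytD b : b \in D -> y t b != 0.
  rewrite !inE => /andP[bt cb]; apply: contraNneq cb => yb.
  by have := yt b bt; rewrite yb mulr0 addr0 => ->.
have yt0 : y t b0 = 0.
  have [->|b0t] := eqVneq b0 t; first exact: yB.
  have cb0 : c b0 = 0 by apply: suppN; apply: contra b0D => h; rewrite /D in_setD1 b0t.
  by have /eqP := yt b0 b0t; rewrite cb0 add0r mulf_eq0 (negPf ct) => /eqP.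
(* Nonzero elements of GF(3) are their own inverses, so multiplying by [y t b] divides by it and
   sends [t] to the all-ones vector on [D]. *)
pose x e := [ffun b => if b \in D then y e b * y t b else 0] : {ffun T -> 'F_3}.
exists D, x, (fun e => y e b0); split.
- split=> [|e le]; first exact: leq_trans (subset_leq_card DB) (indep_leq_rk iB).
  apply: leq_trans (indep_leq_rk iB); apply: proper_card; apply/properP; split=> //.
  by exists b0 => //; apply: contraNT le => /yB->.
- by move=> e b bD; rewrite ffunE (negPf bD).
(* Both halves of [d] have the same [comb], so [d] is a relation through [t]. It exchanges for the
   elements of [s] every coordinate where the combination agrees with [t]. *)
- move=> s ts l0; pose d := delta t - scl_sum s delta - (y t - scl_sum s y).
  have sdelta e : e \notin [seq p.1 | p <- s] -> scl_sum s delta e = 0.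
    move=> es; rewrite scl_sumE big_seq big1 // => p ps; rewrite ffunE.
    rewrite (_ : (e == p.1) = false) ?mulr0 //; apply: contraNF es => /eqP->.
    exact: map_f.
  have sy e : e \notin B -> scl_sum s y e = 0.
    by move=> eB; rewrite scl_sumE big1 // => p _; rewrite yB ?mulr0.
  have dt : d t != 0 by rewrite !ffunE eqxx sdelta // yB // sy // !subr0.
  have cd : comb d = 0.
    rewrite !(combD, combN) !comb_scl_sum comb_delta cy.
    rewrite (eq_bigr (fun p => p.2 *: v p.1)) => [|p _]; last by rewrite comb_delta.
    rewrite [X in _ - (_ - X)](eq_bigr (fun p => p.2 *: v p.1)) => [|p _]; last by rewrite cy.
    by rewrite subrr.
  (* These are the coordinates that survive the exchange; the others in [D] are exactly the ones of
     [scl_sum s x]. *)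
  pose Z := [set b in D | scl_sum s y b != y t b].
  have dsub : supp d \subset t |: ([set e in [seq p.1 | p <- s]] :|: Z).
    apply/subsetP => e; apply: contraTT; rewrite !inE !negb_or negb_and negbK.
    case/and3P=> et es eZ; rewrite negbK !ffunE (negPf et) sdelta // subrr sub0r oppr_eq0.
    rewrite subr_eq0 eq_sym; case/orP: eZ => // eD.
    have [eB|eB] := boolP (e \in B); last by rewrite sy ?yB.
    rewrite (b0P e) //; first by rewrite yt0 scl_sumE l0.
    by rewrite !inE.
  have leZ : (#|D| <= size s + #|Z|)%N.
    have := leq_trans (c_min d dt cd) (subset_leq_card dsub).
    rewrite cD cardsU1 => /leq_trans h.
    have : (#|D|.+1 <= 1 + (size s + #|Z|))%N; last by rewrite add1n ltnS.
    apply: h; apply: leq_add; first by case: (_ \notin _).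
    apply: leq_trans (leq_card_setU _ _) _; rewrite leq_add2r cardsE.
    by rewrite -(size_map fst s) card_size.
  have Zones : (#|Z| + ones (scl_sum s x) = #|D|)%N.
    rewrite -(cardsID Z D) (setIidPr _); last by apply/subsetP => b; rewrite inE => /andP[].
    congr (_ + _)%N; apply: eq_card => b; rewrite inE in_setD in_set (scl_sumE s x).
    have [bD|bD] := boolP (b \in D); last first.
      by rewrite big1 // => p _; rewrite ffunE (negPf bD) mulr0.
    rewrite /= negbK (eq_bigr (fun p => p.2 * y p.1 b * y t b)) => [|p _]; last first.
      by rewrite ffunE bD mulrA.
    rewrite -mulr_suml -scl_sumE -{1}(F3_sqr (ytD b bD)).
    by rewrite (inj_eq (mulIf (ytD b bD))) andbT.
  by rewrite -(leq_add2l #|Z|) Zones addnC.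
- move=> e f a a' exf elf; rewrite -(cy e) -(cy f) -!comb_scl; congr comb.
  apply/ffunP => b; rewrite !ffunE.
  have [bD|bD] := boolP (b \in D).
    move/ffunP/(_ b): exf; rewrite !ffunE bD !mulrA.
    exact: (mulIf (ytD b bD)).
  have [bB|bB] := boolP (b \in B); first by rewrite (b0P b).
  by rewrite !yB ?mulr0.
Qed.

(** If some [l e] is nonzero, then [#|D|] is at most [rk M - 1] and two classes of size at most
    [6 * #|D| + 1] occur beside [t]; otherwise only one class occurs. *)
Lemma loose_card t : simple M -> loose M t -> ~ coloop M t ->
  (#|T| <= 6 * rk M + 2)%N \/ (#|T| + 9 <= 12 * rk M)%N.
Proof.
move=> sM lt nt; have [D [x [l [[leD ltD] xD key inj]]]] := loose_coordinates lt nt.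
pose s e := if l e == 0 then 1 else l e.
have s0 e : s e != 0 by rewrite /s; have [_|] := eqVneq (l e) 0.
have sl e : s e * l e = (l e != 0)%:R.
  by rewrite /s; have [->|l0] := eqVneq (l e) 0; rewrite ?mulr0 ?F3_sqr.
pose w e := scl (s e) (x e).
pose E k := [set e | (e != t) && ((l e != 0) == k)].
(* Equal images would make two elements parallel, giving a relation with support of size at most 2,
   against simplicity. *)
have w_inj k : {in E k &, injective w}.
  move=> e f; rewrite !inE => /andP[et /eqP ek] /andP[ft /eqP fk] ew.
  apply/eqP/negPn/negP => ef.
  have svef : s e *: v e = s f *: v f by apply: inj ew _; rewrite !sl ek fk.
  pose d := scl (s e) (delta e) - scl (s f) (delta f).
  have cd : comb d = 0 by rewrite combD combN !comb_scl !comb_delta svef subrr.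
  have d0 : d != 0.
    apply: contraNneq (s0 e) => /ffunP/(_ e); rewrite !ffunE eqxx (negPf ef).
    by rewrite mulr1 mulr0 subr0 => ->.
  have := simple_supp sM d0 cd; apply/negP; rewrite -leqNgt.
  have <- : #|[set e; f]| = 2%N by rewrite cards2 ef.
  apply/subset_leq_card/subsetP => g; apply: contraTT; rewrite !inE negb_or.
  by case/andP=> ge gf; rewrite !ffunE (negPf ge) (negPf gf) !mulr0 subrr eqxx.
have E_thin k : thin 2 (w @: E k).
  split.
    move=> _ _ /imsetP[e + ->] /imsetP[f + ->] _.
    rewrite !inE => /andP[et /eqP ek] /andP[ft /eqP fk].
    have := key [:: (e, s e); (f, - s f)]; rewrite /scl_sum !big_cons !big_nil /=.
    rewrite !inE negb_or !(eq_sym t) et ft mulNr !sl ek fk addr0 subrr => /(_ isT erefl).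
    rewrite (_ : scl (s e) _ + _ = w e - w f) //; apply/ffunP => b.
    by rewrite !ffunE addr0 mulNr.
  move=> _ _ _ /imsetP[e + ->] /imsetP[f + ->] /imsetP[g + ->] _ _ _.
  rewrite !inE => /andP[et /eqP ek] /andP[ft /eqP fk] /andP[gt /eqP gk].
  (* Within a class the [b0]-coordinates agree, so they cancel in differences and, in characteristic
     3, in triple sums. *)
  have k3 : k%:R + (k%:R + k%:R) = 0 :> 'F_3 by apply/eqP; case: k {ek fk gk}.
  split.
    have := key [:: (e, s e); (f, s f); (g, s g)]; rewrite /scl_sum !big_cons !big_nil /=.
    rewrite !inE !negb_or !(eq_sym t) et ft gt !sl ek fk gk addr0 k3 => /(_ isT erefl).
    by rewrite addr0 addrA.
  have := key [:: (e, - s e); (f, - s f); (g, - s g)]; rewrite /scl_sum !big_cons !big_nil /=.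
  rewrite !inE !negb_or !(eq_sym t) et ft gt !mulNr !sl ek fk gk addr0 -!opprD k3 oppr0.
  move=> /(_ isT erefl).
  rewrite (_ : scl (- s e) _ + _ = - (w e + w f + w g)) //; apply/ffunP => b.
  by rewrite !ffunE addr0 !mulNr -!opprD addrA.
have cE k : (#|E k| <= 6 * #|D| + 1)%N.
  rewrite -(card_in_imset (w_inj k)); apply: thin2_card => //.
  by move=> _ /imsetP[e _ ->] b bD; rewrite ffunE xD ?mulr0.
have cT : #|T| = (#|E true| + #|E false|).+1.
  rewrite -cardsT (cardsD1 t) inE add1n -(cardsID [set e | l e != 0]); congr (_ + _).+1.
    by apply: eq_card => e; rewrite !inE eqb_id andbT.
  by apply: eq_card => e; rewrite !inE eqbF_neg andbT andbC.
have [/existsP[e le]|/existsPn noe] := boolP [exists e, l e != 0].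
  by right; have := ltD e le; have := cE true; have := cE false; rewrite cT; lia.
left; have -> : #|T| = #|E false|.+1.
  rewrite cT (_ : E true = set0) ?cards0 ?add0n //; apply/setP => e.
  by rewrite !inE (negPf (noe e)) andbF.
by have := cE false; lia.
Qed.

End Relations.
End Matroid.

Local Close Scope ring_scope.

Theorem theorem3p1 (T : finType) (M : matroid T) (r : nat) :
  5 <= r -> rk M = r -> simple M -> ternary M ->
  (exists t : T, loose M t) -> (forall e : T, ~ coloop M e) ->
  (10 < r -> #|T| <= (41 * r - 101) %/ 2) /\
  (r <= 10 -> #|T| <= (35 * r - 35) %/ 2).
Proof.
move=> r5 rkM sM [n [v vP]] [t lt] nocoloop.
have := loose_card vP sM lt (nocoloop t); rewrite rkM => cT.
(* After doubling, the tightest comparisons are [24r - 18 <= 41r - 101] and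
   [24r - 18 <= 35r - 35]. *)
by split=> hr; rewrite leq_divRL //; case: cT; lia.
Qed.
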